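(* Let $E\subseteq\mathbb{R}$ and let $f:E\to\mathbb{R}$ be a down continuous function. Then $f$ is continuous on $E$ (in the ordinary sense).
   Context: A sequence $(\alpha_k)_{k\in\mathbb{N}}$ of real numbers is called downward half Cauchy if for each $\varepsilon>0$ there exists $n_0\in\mathbb{N}$ such that $\alpha_m-\alpha_n<\varepsilon$ for all $m\geq n\geq n_0$. For $E\subseteq\mathbb{R}$, a function $f:E\to\mathbb{R}$ is called down continuous if it preserves downward half Cauchy sequences, i.e. the sequence $(f(\alpha_k))$ is downward half Cauchy whenever $(\alpha_k)$ is a downward half Cauchy sequence of points in $E$. *)

(* Defs.v *)
From mathcomp Require Import all_boot all_order all_algebra.
From mathcomp Require Import all_classical all_reals all_analysis.
Set Implicit Arguments.
Unset Strict Implicit.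
Unset Printing Implicit Defensive.
Import Order.TTheory GRing.Theory Num.Theory.
Import numFieldNormedType.Exports.
Local Open Scope classical_set_scope.
Local Open Scope ring_scope.

Definition downward_half_cauchy (R : realType) (a : nat -> R) : Prop :=
  forall eps : R, 0 < eps ->
    exists n0 : nat, forall m n : nat,
      (n0 <= n)%N -> (n <= m)%N -> a m - a n < eps.

(* A function E -> R is encoded as a total function R -> R of which only the
   values on E are constrained. *)
Definition down_continuous (R : realType) (E : set R) (f : R -> R) : Prop :=
  forall a : nat -> R, (forall k, E (a k)) ->
    downward_half_cauchy a -> downward_half_cauchy (fun k => f (a k)).

(* Main.v *)
Require Import Defs.
From mathcomp Require Import all_boot all_order all_algebra.
From mathcomp Require Import all_classical all_reals all_analysis.
Import Order.TTheory GRing.Theory Num.Theory.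
Import numFieldNormedType.Exports.
Local Open Scope classical_set_scope.
Local Open Scope ring_scope.

(** If [f] were discontinuous within [E] at a point [x] of [E], there would be
    points [u k] of [E] converging to [x] with [f (u k)] staying at distance at
    least [e] from [f x].  Let a sequence alternate between the [u k] and [x]:
    it still converges to [x], so it is downward half Cauchy, and hence so is
    its image.  The half Cauchy condition bounds only the increases of a
    sequence, but in the alternating image every increase from [f x] up to
    [f (u k)] and every increase from [f (u k)] up to [f x] occurs between
    consecutive terms.  Both signs of [f (u k) - f x] are thus controlled, and
    [f (u k)] is eventually within [e] of [f x]: a contradiction. *)

Lemma cvg_downward_half_cauchy (R : realType) (a : nat -> R) (l : R) :
  a @ \oo --> l -> downward_half_cauchy a.
Proof.
move=> al e e0; have e20 : 0 < e / 2 by rewrite divr_gt0.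
have /cvgrPdist_lt/(_ _ e20)[N _ aN] := al.
exists N => m n Nn nm; rewrite (le_lt_trans (ler_norm _))// (splitr e).
have := ltrD (aN _ (leq_trans Nn nm)) (aN _ Nn).
by apply: le_lt_trans; rewrite (distrC l (a m)) ler_distD.
Qed.

Lemma not_within_continuous_seq (R : realType) (E : set R) (f : R -> R) (x e : R) :
  ~ (\forall y \near within E (nbhs x), `|f x - f y| < e) ->
  exists2 u : nat -> R, u @ \oo --> x &
    forall k, E (u k) /\ e <= `|f x - f (u k)|.
Proof.
move=> nf.
have /choice[u uP] : forall k : nat, exists y,
    [/\ `|x - y| < k.+1%:R^-1, E y & e <= `|f x - f y|].
  move=> k; apply: contrapT => nex; apply: nf.
  have k0 : 0 < k.+1%:R^-1 :> R by rewrite invr_gt0.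
  rewrite /within /=; apply/nbhs_ballP; exists k.+1%:R^-1 => //= y xy Ey.
  by rewrite ltNge; apply/negP => fy; apply: nex; exists y.
exists u; last by move=> k; case: (uP k).
apply/cvgrPdist_lt => d d0.
have [N _ hN] := near_infty_natSinv_lt (PosNum d0).
exists N => // k /hN; have [uk _ _] := uP k.
exact: lt_trans.
Qed.

Lemma cvg_alternate (R : realType) (u : nat -> R) (x : R) :
  u @ \oo --> x -> (fun k => if odd k then x else u k) @ \oo --> x.
Proof.
move=> /cvgrPdist_lt ux; apply/cvgrPdist_lt => d d0.
have [N _ uN] := ux d d0; exists N => // k Nk.
by case: ifP => _; [rewrite subrr normr0|exact: uN].
Qed.

Theorem theorem3 (R : realType) (E : set R) (f : R -> R)
    (hf : down_continuous E f) : {within E, continuous f}.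
Proof.
apply/subspace_continuousP => x Ex; apply/cvgrPdist_lt => e e0.
apply: contrapT => /not_within_continuous_seq[u ux uP].
pose a k := if odd k then x else u k.
have aE k : E (a k) by rewrite /a; case: ifP => // _; case: (uP k).
have [N aN] := hf _ aE (cvg_downward_half_cauchy _ _ _ (cvg_alternate _ _ _ ux)) e e0.
(* An even index beyond [N] whose predecessor is also beyond [N]. *)
pose k := N.+1.*2.
have ak : a k = u k by rewrite /a odd_double.
have aSk : a k.+1 = x by rewrite /a /= odd_double.
have aPk : a k.-1 = x by rewrite /a /= odd_double.
have Nk : (N <= k.-1)%N.
  by rewrite /k doubleS /= -addnn -addnS leq_addr.
have down := aN k.+1 k (leq_trans Nk (leq_pred k)) (leqnSn k).
have up := aN k k.-1 Nk (leq_pred k).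
rewrite aSk ak in down; rewrite ak aPk in up.
have [_] := uP k; rewrite leNgt => /negP; apply.
by rewrite ltr_norml down andbT ltrNl opprB.
Qed.
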